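(* Let $t>0$ (equivalently, let $s>1$ and $s-2t=1$), and let $$g_t(r)=\sum_{n=1}^\infty \frac1n\sin^2(n^{-t}r),\qquad r\ge0.$$ Then $$g_t(r)=\frac{1}{2t}\ln r\,(1+o(1)),\qquad r\to\infty.$$ *)

(* Defs.v *)
From Stdlib Require Import Reals Lra Lia.
From Coquelicot Require Import Coquelicot.
Open Scope R_scope.

(* The index [n >= 1] is [S k], [k >= 0]; [n^{-t}] is the real power
   [exp (- t * ln n)]. *)
Definition g (t r : R) : R :=
  Series (fun k : nat => / INR (S k) * (sin (Rpower (INR (S k)) (- t) * r)) ^ 2).

Lemma Rpower_telescope (a m : R) : 0 < a -> 0 < m ->
  a * Rpower (m + 1) (- a) * / (m + 1) <= Rpower m (- a) - Rpower (m + 1) (- a).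
Proof.
intros Ha Hm.
assert (Hln : / (m + 1) <= ln (m + 1) - ln m).
{ assert (H := exp_ineq1_le (ln m - ln (m + 1))).
  rewrite <- ln_div in H by lra.
  rewrite exp_ln in H by (apply Rdiv_lt_0_compat; lra).
  rewrite ln_div in H by lra.
  replace (m / (m + 1)) with (1 - / (m + 1)) in H by (field; lra). lra. }
assert (E : Rpower m (- a) =
            Rpower (m + 1) (- a) * exp (a * (ln (m + 1) - ln m))).
{ unfold Rpower. rewrite <- exp_plus. f_equal. ring. }
rewrite E.
assert (HP : 0 < Rpower (m + 1) (- a)) by apply exp_pos.
assert (H := exp_ineq1_le (a * (ln (m + 1) - ln m))).
assert (a * / (m + 1) <= a * (ln (m + 1) - ln m))
  by (apply Rmult_le_compat_l; lra).
nra.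
Qed.

Lemma ex_series_Rpower (a : R) : 0 < a ->
  ex_series (fun k : nat => Rpower (INR (S k)) (- a) * / INR (S k)).
Proof.
intros Ha.
assert (Hpos : forall k, 0 < INR (S k)) by (intros k; apply lt_0_INR; lia).
assert (Hterm : forall k, 0 < Rpower (INR (S k)) (- a) * / INR (S k)).
{ intros k. apply Rmult_lt_0_compat; [apply exp_pos|].
  apply Rinv_0_lt_compat, Hpos. }
set (u := fun k : nat => Rpower (INR (S k)) (- a) * / INR (S k)).
assert (Hb : forall n, sum_n u n <= 1 + / a * (1 - Rpower (INR (S n)) (- a))).
{ induction n as [|n IH].
  - rewrite sum_O. unfold u. simpl INR. unfold Rpower.
    rewrite ln_1, Rmult_0_r, exp_0. lra.
  - rewrite sum_Sn. change plus with Rplus.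
    assert (H := Rpower_telescope a (INR (S n)) Ha (Hpos n)).
    rewrite <- S_INR in H.
    assert (Hu : u (S n) <=
      / a * (Rpower (INR (S n)) (- a) - Rpower (INR (S (S n))) (- a))).
    { apply Rmult_le_reg_l with a; [lra|].
      rewrite <- Rmult_assoc, Rinv_r, Rmult_1_l by lra.
      unfold u. lra. }
    lra. }
assert (L : ex_finite_lim_seq (sum_n u)).
{ apply ex_finite_lim_seq_incr with (1 + / a).
  - intros n. rewrite sum_Sn. change plus with Rplus.
    assert (H := Hterm (S n)). unfold u at 3. lra.
  - intros n. apply Rle_trans with (1 := Hb n).
    assert (0 < / a) by (apply Rinv_0_lt_compat; lra).
    assert (0 < Rpower (INR (S n)) (- a)) by apply exp_pos. nra. }
destruct L as [l Hl]. exists l. exact Hl.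
Qed.

Lemma sin_sqr_le (x : R) : (sin x) ^ 2 <= x ^ 2.
Proof.
assert (P : forall y, 0 <= y -> (sin y) ^ 2 <= y ^ 2).
{ intros y Hy. destruct (Rle_lt_dec 1 y) as [H1|H1].
  - assert (H := SIN_bound y). nra.
  - destruct (Req_dec y 0) as [->|Hn]; [rewrite sin_0; lra|].
    assert (H := sin_lt_x y ltac:(lra)).
    assert (0 < sin y) by (apply sin_gt_0; [lra|assert (H' := PI2_1); lra]).
    nra. }
destruct (Rle_lt_dec 0 x) as [H|H]; [now apply P|].
assert (Q := P (- x) ltac:(lra)). rewrite sin_neg in Q. nra.
Qed.

(* For [t > 0] the series converges, so [Series] returns its actual sum. *)
Lemma is_series_g (t r : R) : 0 < t ->
  is_series (fun k : nat =>
    / INR (S k) * (sin (Rpower (INR (S k)) (- t) * r)) ^ 2) (g t r).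
Proof.
intros Ht. apply Series_correct.
apply (@ex_series_le R_AbsRing R_CompleteNormedModule) with
  (fun k => r ^ 2 * (Rpower (INR (S k)) (- (2 * t)) * / INR (S k))).
2: { apply (@ex_series_scal_l R_AbsRing R_NormedModule (r ^ 2)
       (fun k => Rpower (INR (S k)) (- (2 * t)) * / INR (S k))).
     apply ex_series_Rpower. lra. }
intros k. change norm with Rabs.
assert (Hi : 0 < / INR (S k)) by (apply Rinv_0_lt_compat, lt_0_INR; lia).
rewrite Rabs_pos_eq by (apply Rmult_le_pos; [lra|apply pow2_ge_0]).
replace (- (2 * t)) with (- t + - t) by ring. rewrite Rpower_plus.
assert (H := sin_sqr_le (Rpower (INR (S k)) (- t) * r)).
replace (r ^ 2 * (Rpower (INR (S k)) (- t) * Rpower (INR (S k)) (- t) * / INR (S k)))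
  with (/ INR (S k) * (Rpower (INR (S k)) (- t) * r) ^ 2) by ring.
apply Rmult_le_compat_l; lra.
Qed.

(* Main.v *)
(* Since [sin^2 x = (1 - cos 2x) / 2] and the terms with [n > r^(1/t)] contribute [O(1)], it
   suffices that the sum of [cos (2 r n^(-t)) / n] over [n < r^(1/t)] is [o(ln r)].
   Cut the range at the powers [r^(1/(t+k))]. On the block from [r^(1/(t+k+1))] to
   [r^(1/(t+k))], [k] applications of van der Corput differencing with bounded shifts (for the
   weights [1/n], which are almost shift invariant) replace the phase by its [k]-fold
   differences, of size [r n^(-t-k)]. Away from the ends of the block these have increments
   [d n -> 0] with [n d n -> oo], and Abel summation gives cancellation. Finitely many blocks
   reach down to [r^(1/(t+K))], below which the trivial bound is [ln r / (t + K)]. *)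
Require Import Defs.
From Stdlib Require Import Reals ZArith Lra Lia List.
From Coquelicot Require Import Coquelicot.
Open Scope R_scope.

(** * Finite sums over half-open integer ranges, and Abel summation *)

Fixpoint rsum_len (f : nat -> R) (a m : nat) : R :=
  match m with
  | O => 0
  | S m => rsum_len f a m + f (a + m)%nat
  end.

(** The subtraction is truncated, so the sum over [[a, b)] is [0] when [b <= a]. *)
Definition rsum (f : nat -> R) (a b : nat) : R := rsum_len f a (b - a).

Lemma rsum_nil (f : nat -> R) (a : nat) : rsum f a a = 0.
Proof. unfold rsum. now rewrite Nat.sub_diag. Qed.

Lemma rsum_S (f : nat -> R) (a b : nat) : (a <= b)%nat ->
  rsum f a (S b) = rsum f a b + f b.
Proof.
intros Hab. unfold rsum. replace (S b - a)%nat with (S (b - a)) by lia.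
simpl. do 2 f_equal. lia.
Qed.

Lemma rsum_Chasles (f : nat -> R) (a b c : nat) : (a <= b)%nat -> (b <= c)%nat ->
  rsum f a c = rsum f a b + rsum f b c.
Proof.
intros Hab Hbc. induction Hbc as [|c Hbc IH].
- rewrite rsum_nil. lra.
- rewrite !rsum_S by lia. lra.
Qed.

Lemma rsum_le (f g : nat -> R) (a b : nat) :
  (forall n, (a <= n < b)%nat -> f n <= g n) -> rsum f a b <= rsum g a b.
Proof.
intros Hfg. destruct (Nat.le_gt_cases a b) as [Hab|Hba].
- induction Hab as [|b Hab IH].
  + rewrite !rsum_nil. lra.
  + rewrite !rsum_S by lia. apply Rplus_le_compat.
    * apply IH. intros n Hn. apply Hfg. lia.
    * apply Hfg. lia.
- unfold rsum. replace (b - a)%nat with 0%nat by lia. simpl. lra.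
Qed.

Lemma rsum_ext (f g : nat -> R) (a b : nat) :
  (forall n, (a <= n < b)%nat -> f n = g n) -> rsum f a b = rsum g a b.
Proof.
intros Hfg. apply Rle_antisym; apply rsum_le; intros n Hn; rewrite Hfg by easy; lra.
Qed.

Lemma rsum_plus (f g : nat -> R) (a b : nat) :
  rsum (fun n => f n + g n) a b = rsum f a b + rsum g a b.
Proof. unfold rsum. induction (b - a)%nat as [|m IH]; simpl; lra. Qed.

Lemma rsum_scal (c : R) (f : nat -> R) (a b : nat) :
  rsum (fun n => c * f n) a b = c * rsum f a b.
Proof. unfold rsum. induction (b - a)%nat as [|m IH]; simpl; lra. Qed.

Lemma rsum_abs (f : nat -> R) (a b : nat) :
  Rabs (rsum f a b) <= rsum (fun n => Rabs (f n)) a b.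
Proof.
unfold rsum. induction (b - a)%nat as [|m IH]; simpl.
- rewrite Rabs_R0. lra.
- apply Rle_trans with (1 := Rabs_triang _ _). lra.
Qed.

Lemma rsum_const (c : R) (a b : nat) : rsum (fun _ => c) a b = INR (b - a) * c.
Proof.
unfold rsum. induction (b - a)%nat as [|m IH].
- simpl. lra.
- rewrite S_INR. simpl. lra.
Qed.

Lemma rsum_exchange (F : nat -> nat -> R) (a b c d : nat) :
  rsum (fun n => rsum (F n) c d) a b = rsum (fun k => rsum (fun n => F n k) a b) c d.
Proof.
unfold rsum at 1 4. induction (b - a)%nat as [|m IH]; simpl.
- rewrite rsum_const. lra.
- rewrite rsum_plus. lra.
Qed.

Lemma rsum_telescope (f : nat -> R) (a b : nat) : (a <= b)%nat ->
  rsum (fun n => f (S n) - f n) a b = f b - f a.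
Proof.
intros Hab. induction Hab as [|b Hab IH].
- rewrite rsum_nil. lra.
- rewrite rsum_S by lia. lra.
Qed.

(** This isolates the diagonal of a double sum: a row [h] meets the diagonal at most once. *)
Lemma rsum_delta (c : R) (h H : nat) : 0 <= c ->
  rsum (fun k => if Nat.eqb h k then c else 0) 0 H <= c.
Proof.
intros Hc.
assert (E : rsum (fun k => if Nat.eqb h k then c else 0) 0 H =
            if Nat.ltb h H then c else 0).
{ induction H as [|H IH].
  - rewrite rsum_nil. now destruct h.
  - rewrite rsum_S, IH by lia.
    destruct (Nat.eqb_spec h H); destruct (Nat.ltb_spec h H);
      destruct (Nat.ltb_spec h (S H)); try lia; lra. }
rewrite E. destruct (Nat.ltb h H); lra.
Qed.

(** Summation by parts moves the difference from the bounded [v] to the weight [w], at the price of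
    two boundary terms and the total variation of [w]. *)
Lemma Abel_variation_bound (v w : nat -> R) (a b : nat) :
  (forall n, Rabs (v n) <= 1) -> (a <= b)%nat ->
  Rabs (rsum (fun n => w n * (v (S n) - v n)) a b) <=
  Rabs (w a) + Rabs (w b) + rsum (fun n => Rabs (w (S n) - w n)) a b.
Proof.
intros Hv Hab.
assert (P : forall x n, Rabs (x * v n) <= Rabs x).
{ intros x n. rewrite Rabs_mult. specialize (Hv n).
  assert (H := Rabs_pos x). nra. }
(* With the boundary term at [b] subtracted, raising [b] by one adds exactly
   [- (w (S b) - w b) * v (S b)], so the induction closes. *)
assert (E : Rabs (rsum (fun n => w n * (v (S n) - v n)) a b - w b * v b) <=
  Rabs (w a) + rsum (fun n => Rabs (w (S n) - w n)) a b).
{ induction Hab as [|b Hab IH].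
  - rewrite !rsum_nil. replace (0 - w a * v a) with (- (w a * v a)) by ring.
    rewrite Rabs_Ropp. specialize (P (w a) a). lra.
  - rewrite !rsum_S by lia.
    match goal with |- Rabs (?s + _ - _) <= _ =>
      replace (s + w b * (v (S b) - v b) - w (S b) * v (S b))
        with ((s - w b * v b) + - ((w (S b) - w b) * v (S b))) by ring end.
    apply Rle_trans with (1 := Rabs_triang _ _). rewrite Rabs_Ropp.
    specialize (P (w (S b) - w b) (S b)). lra. }
match goal with |- Rabs ?s <= _ =>
  replace s with ((s - w b * v b) + w b * v b) by ring end.
apply Rle_trans with (1 := Rabs_triang _ _). specialize (P (w b) b). lra.
Qed.

(** * Sums with harmonic weights *)

Definition harm (a b : nat) : R := rsum (fun n => / INR n) a b.

Lemma INR_ge_1 (n : nat) : (1 <= n)%nat -> 1 <= INR n.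
Proof. intros H. apply (le_INR 1 n H). Qed.

Lemma ln_succ_bounds (x : R) : 0 < x -> / (x + 1) <= ln (x + 1) - ln x <= / x.
Proof.
intros Hx. split.
- assert (H := exp_ineq1_le (ln x - ln (x + 1))).
  rewrite <- ln_div, exp_ln in H by (try apply Rdiv_lt_0_compat; lra).
  rewrite ln_div in H by lra.
  replace (x / (x + 1)) with (1 - / (x + 1)) in H by (field; lra). lra.
- assert (H := exp_ineq1_le (ln (x + 1) - ln x)).
  rewrite <- ln_div, exp_ln in H by (try apply Rdiv_lt_0_compat; lra).
  rewrite ln_div in H by lra.
  replace ((x + 1) / x) with (1 + / x) in H by (field; lra). lra.
Qed.

Lemma harm_bounds (a b : nat) : (1 <= a)%nat -> (a <= b)%nat ->
  ln (INR b) - ln (INR a) <= harm a b <= ln (INR b) - ln (INR a) + 1.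
Proof.
intros Ha Hab.
(* The extra [/ INR a - / INR b] telescopes and pays for the gap between [1/b] and
   [1/(b+1) <= ln (b+1) - ln b]. *)
assert (E : ln (INR b) - ln (INR a) <= harm a b <=
            ln (INR b) - ln (INR a) + / INR a - / INR b).
{ unfold harm. induction Hab as [|b Hab IH].
  - rewrite rsum_nil. lra.
  - rewrite rsum_S, S_INR by lia.
    assert (H := INR_ge_1 b ltac:(lia)).
    assert (H1 := ln_succ_bounds (INR b) ltac:(lra)). lra. }
assert (Ha1 := INR_ge_1 a Ha). assert (Hb1 := INR_ge_1 b ltac:(lia)).
assert (0 < / INR b) by (apply Rinv_0_lt_compat; lra).
assert (/ INR a <= 1) by (rewrite <- Rinv_1; apply Rinv_le_contravar; lra).
lra.
Qed.

Lemma rsum_inv_le (v : nat -> R) (a b : nat) : (1 <= a)%nat ->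
  (forall n, Rabs (v n) <= 1) ->
  Rabs (rsum (fun n => / INR n * v n) a b) <= harm a b.
Proof.
intros Ha Hv. apply Rle_trans with (1 := rsum_abs _ _ _).
apply rsum_le. intros n Hn.
assert (H := INR_ge_1 n ltac:(lia)).
assert (0 < / INR n) by (apply Rinv_0_lt_compat; lra).
rewrite Rabs_mult, (Rabs_pos_eq (/ INR n)) by lra.
specialize (Hv n). nra.
Qed.

(** A unit shift is an Abel summation against [1/n]: the boundary terms and the variation
    [1/a - 1/b] add up to [2/a <= 2]. A shift by [h] is [h] unit shifts. *)
Lemma rsum_inv_shift (v : nat -> R) (a b h : nat) : (1 <= a)%nat -> (a <= b)%nat ->
  (forall n, Rabs (v n) <= 1) ->
  Rabs (rsum (fun n => / INR n * v (n + h)%nat) a b - rsum (fun n => / INR n * v n) a b)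
  <= 2 * INR h.
Proof.
intros Ha Hab Hv. induction h as [|h IH].
- rewrite (rsum_ext (fun n => / INR n * v (n + 0)%nat) (fun n => / INR n * v n))
    by (intros n _; now rewrite Nat.add_0_r).
  rewrite Rminus_diag, Rabs_R0. simpl. lra.
- assert (H := Abel_variation_bound (fun n => v (n + h)%nat) (fun n => / INR n) a b
    (fun n => Hv _) Hab).
  cbv beta in H.
  assert (V : rsum (fun n => Rabs (/ INR (S n) - / INR n)) a b = / INR a - / INR b).
  { rewrite (rsum_ext _ (fun n => (- / INR (S n)) - (- / INR n))).
    - rewrite (rsum_telescope (fun n => - / INR n)) by easy. lra.
    - intros n Hn. rewrite Rabs_left1; [lra|].
      assert (H1 := INR_ge_1 n ltac:(lia)).
      assert (/ INR (S n) <= / INR n)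
        by (apply Rinv_le_contravar; [|rewrite S_INR]; lra).
      lra. }
  rewrite V in H.
  assert (Ha1 := INR_ge_1 a Ha). assert (Hb1 := INR_ge_1 b ltac:(lia)).
  assert (0 < / INR b) by (apply Rinv_0_lt_compat; lra).
  assert (0 < / INR a) by (apply Rinv_0_lt_compat; lra).
  assert (/ INR a <= 1) by (rewrite <- Rinv_1; apply Rinv_le_contravar; lra).
  rewrite (Rabs_pos_eq (/ INR a)), (Rabs_pos_eq (/ INR b)) in H by lra.
  rewrite (rsum_ext _ (fun n => / INR n * v (n + S h)%nat + (-1) * (/ INR n * v (n + h)%nat)))
    in H by (intros n _; rewrite <- plus_n_Sm; simpl; ring).
  rewrite rsum_plus, rsum_scal in H. rewrite S_INR.
  match goal with |- Rabs (?x - ?y) <= _ => match type of IH with Rabs (?z - _) <= _ =>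
    replace (x - y) with ((x + -1 * z) + (z - y)) by ring end end.
  apply Rle_trans with (1 := Rabs_triang _ _). lra.
Qed.

(** * The van der Corput inequality *)

(** The double sum is the squared modulus of the sum of [e^(i th h)], that is, the square of the
    cosine sum plus that of the sine sum. *)
Lemma cos_sum_sqr_le (th : nat -> R) (H : nat) :
  (rsum (fun h => cos (th h)) 0 H) ^ 2 <=
  rsum (fun h => rsum (fun k => cos (th h - th k)) 0 H) 0 H.
Proof.
assert (E : rsum (fun h => rsum (fun k => cos (th h - th k)) 0 H) 0 H =
  (rsum (fun h => cos (th h)) 0 H) ^ 2 + (rsum (fun h => sin (th h)) 0 H) ^ 2).
{ rewrite (rsum_ext _ (fun h => rsum (fun k => cos (th k)) 0 H * cos (th h) +
     rsum (fun k => sin (th k)) 0 H * sin (th h))).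
  - rewrite rsum_plus, !rsum_scal. ring.
  - intros h _. rewrite (rsum_ext _ (fun k => cos (th h) * cos (th k) + sin (th h) * sin (th k)))
      by (intros k _; apply cos_minus).
    rewrite rsum_plus, !rsum_scal. ring. }
rewrite E. assert (P := pow2_ge_0 (rsum (fun h => sin (th h)) 0 H)). lra.
Qed.

Lemma Rabs_cos_le (x : R) : Rabs (cos x) <= 1.
Proof. apply Rabs_le. apply COS_bound. Qed.

(** The sum is replaced by its average over the shifts [h < H], and the square of the inner average
    is opened into correlations. A weighted AM-GM with parameter [eta] stands in for Cauchy-Schwarz,
    which keeps the bound free of square roots. *)
Lemma van_der_Corput_inequality (th : nat -> R) (a b H : nat) (eta : R) :
  (1 <= a)%nat -> (a <= b)%nat -> (1 <= H)%nat -> 0 < eta ->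
  Rabs (rsum (fun n => / INR n * cos (th n)) a b) <=
  2 * INR H + eta / 2 * harm a b +
  / (2 * eta * INR H ^ 2) *
    rsum (fun h => rsum (fun k =>
      rsum (fun n => / INR n * cos (th (n + h)%nat - th (n + k)%nat)) a b) 0 H) 0 H.
Proof.
intros Ha Hab HH Heta.
assert (HH1 := INR_ge_1 H HH).
set (C := fun n => rsum (fun h => cos (th (n + h)%nat)) 0 H).
set (s := rsum (fun n => / INR n * cos (th n)) a b).
set (Q := rsum _ 0 H).
(* Each of the [H] shifts costs at most [2 H]; the division by [H] is left to the end. *)
assert (E1 : Rabs (INR H * s - rsum (fun n => / INR n * C n) a b) <= 2 * INR H * INR H).
{ rewrite (rsum_ext (fun n => / INR n * C n)
    (fun n => rsum (fun h => / INR n * cos (th (n + h)%nat)) 0 H))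
    by (intros n _; unfold C; now rewrite rsum_scal).
  rewrite rsum_exchange.
  replace (INR H * s) with (rsum (fun _ => s) 0 H)
    by (rewrite rsum_const, Nat.sub_0_r; ring).
  match goal with |- Rabs (?x - ?y) <= _ => replace (x - y) with (x + (-1) * y) by ring end.
  rewrite <- rsum_scal, <- rsum_plus.
  apply Rle_trans with (1 := rsum_abs _ _ _).
  apply Rle_trans with (rsum (fun _ => 2 * INR H) 0 H).
  2: { rewrite rsum_const, Nat.sub_0_r. lra. }
  apply rsum_le. intros h Hh.
  assert (P := rsum_inv_shift (fun n => cos (th n)) a b h Ha Hab (fun n => Rabs_cos_le _)).
  rewrite Rabs_minus_sym in P. unfold s.
  assert (INR h <= INR H) by (apply le_INR; lia).
  match goal with |- Rabs (?x + -1 * ?y) <= _ =>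
    replace (x + -1 * y) with (x - y) by ring end.
  lra. }
assert (E2 : Rabs (rsum (fun n => / INR n * C n) a b) <=
  INR H * (eta / 2 * harm a b + / (2 * eta * INR H ^ 2) * Q)).
{ apply Rle_trans with (1 := rsum_abs _ _ _).
  apply Rle_trans with (rsum (fun n => INR H * (eta / 2) * / INR n +
    INR H * / (2 * eta * INR H ^ 2) * (/ INR n *
      rsum (fun h => rsum (fun k => cos (th (n + h)%nat - th (n + k)%nat)) 0 H) 0 H)) a b).
  - apply rsum_le. intros n Hn.
    assert (Hn1 := INR_ge_1 n ltac:(lia)).
    assert (0 < / INR n) by (apply Rinv_0_lt_compat; lra).
    rewrite Rabs_mult, (Rabs_pos_eq (/ INR n)) by lra.
    assert (P := cos_sum_sqr_le (fun h => th (n + h)%nat) H).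
    change (C n ^ 2 <= rsum (fun h => rsum (fun k =>
      cos (th (n + h)%nat - th (n + k)%nat)) 0 H) 0 H) in P.
    match type of P with _ <= ?d => set (D := d) in * end.
    (* AM-GM: [|C| <= H eta / 2 + C^2 / (2 eta H)] *)
    assert (K : Rabs (C n) <= INR H * (eta / 2) + INR H * / (2 * eta * INR H ^ 2) * C n ^ 2).
    { rewrite <- (pow2_abs (C n)). set (c := Rabs (C n)).
      assert (0 <= / (2 * eta * INR H) * (c - eta * INR H) ^ 2).
      { apply Rmult_le_pos; [|apply pow2_ge_0].
        apply Rlt_le, Rinv_0_lt_compat. nra. }
      replace (INR H * (eta / 2) + INR H * / (2 * eta * INR H ^ 2) * c ^ 2)
        with (c + / (2 * eta * INR H) * (c - eta * INR H) ^ 2) by (field; lra).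
      lra. }
    assert (0 < INR H * / (2 * eta * INR H ^ 2)).
    { apply Rmult_lt_0_compat; [lra|]. apply Rinv_0_lt_compat.
      apply Rmult_lt_0_compat; [lra|apply pow_lt; lra]. }
    replace (INR H * (eta / 2) * / INR n + INR H * / (2 * eta * INR H ^ 2) * (/ INR n * D))
      with (/ INR n * (INR H * (eta / 2) + INR H * / (2 * eta * INR H ^ 2) * D)) by ring.
    apply Rmult_le_compat_l; [lra|]. apply Rle_trans with (1 := K). nra.
  - rewrite rsum_plus, !rsum_scal. fold (harm a b).
    assert (EQ : rsum (fun n => / INR n * rsum (fun h => rsum (fun k =>
      cos (th (n + h)%nat - th (n + k)%nat)) 0 H) 0 H) a b = Q).
    { rewrite (rsum_ext _ (fun n => rsum (fun h => rsum (fun k =>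
        / INR n * cos (th (n + h)%nat - th (n + k)%nat)) 0 H) 0 H)).
      - rewrite rsum_exchange. apply rsum_ext. intros h _. apply rsum_exchange.
      - intros n _. rewrite <- rsum_scal. apply rsum_ext. intros h _.
        now rewrite <- rsum_scal. }
    rewrite EQ. lra. }
apply Rmult_le_reg_l with (INR H); [lra|].
rewrite <- (Rabs_pos_eq (INR H)) at 1 by lra. rewrite <- Rabs_mult.
replace (INR H * s) with
  ((INR H * s - rsum (fun n => / INR n * C n) a b) + rsum (fun n => / INR n * C n) a b) by ring.
apply Rle_trans with (1 := Rabs_triang _ _). lra.
Qed.

(** * Functions that are [o(ln r)] *)

Lemma eventually_and {P Q : R -> Prop} : Rbar_locally p_infty P -> Rbar_locally p_infty Q ->
  Rbar_locally p_infty (fun r => P r /\ Q r).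
Proof. apply filter_and. Qed.

Lemma eventually_imp (P Q : R -> Prop) : (forall r, P r -> Q r) ->
  Rbar_locally p_infty P -> Rbar_locally p_infty Q.
Proof. apply filter_imp. Qed.

Definition sublog (f : R -> R) : Prop :=
  forall eps, 0 < eps -> Rbar_locally p_infty (fun r => Rabs (f r) <= eps * ln r).

Lemma eventually_ge (m : R) : Rbar_locally p_infty (fun r => m <= r).
Proof. exists m. intros r Hr. lra. Qed.

Lemma eventually_ln_ge (m : R) : Rbar_locally p_infty (fun r => m <= ln r).
Proof.
exists (exp m). intros r Hr. rewrite <- (ln_exp m).
apply ln_le; [apply exp_pos|lra].
Qed.

Lemma eventually_bounded_forall (P : nat -> R -> Prop) (H : nat) :
  (forall h, Rbar_locally p_infty (P h)) ->
  Rbar_locally p_infty (fun r => forall h, (h < H)%nat -> P h r).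
Proof.
intros HP. induction H as [|H IH].
- apply filter_forall. intros r h Hh. lia.
- generalize (eventually_and IH (HP H)). apply eventually_imp.
  intros r [H1 H2] h Hh. destruct (Nat.eq_dec h H) as [->|Hn]; [easy|].
  apply H1. lia.
Qed.

Lemma sublog_plus (f g : R -> R) : sublog f -> sublog g -> sublog (fun r => f r + g r).
Proof.
intros Hf Hg eps Heps.
generalize (eventually_and (Hf (eps / 2) ltac:(lra)) (Hg (eps / 2) ltac:(lra))).
apply eventually_imp. intros r [H1 H2].
apply Rle_trans with (1 := Rabs_triang _ _). lra.
Qed.

(** Bounded errors are absorbed because [ln r] tends to infinity. *)
Lemma sublog_of_bounded_diff (f g : R -> R) (m : R) : sublog f ->
  Rbar_locally p_infty (fun r => Rabs (g r - f r) <= m) -> sublog g.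
Proof.
intros Hf Hm eps Heps.
generalize (eventually_and (Hf (eps / 2) ltac:(lra))
  (eventually_and Hm (eventually_ln_ge (2 * m / eps)))).
apply eventually_imp. intros r [H1 [H2 H3]].
replace (g r) with ((g r - f r) + f r) by ring.
apply Rle_trans with (1 := Rabs_triang _ _).
apply (Rmult_le_compat_l (eps / 2)) in H3; [|lra].
replace (eps / 2 * (2 * m / eps)) with m in H3 by (field; lra). lra.
Qed.

Lemma sublog_ext (f g : R -> R) : sublog f ->
  Rbar_locally p_infty (fun r => f r = g r) -> sublog g.
Proof.
intros Hf Hfg. apply sublog_of_bounded_diff with f 0; [easy|].
revert Hfg. apply eventually_imp. intros r ->. rewrite Rminus_diag, Rabs_R0. lra.
Qed.

(** * Differencing of oscillating sums *)

(** The frequency [r] is kept apart from [phi], so that differencing acts on a phase independent of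
    [r]. *)
Definition osc (phi : R -> R) (a b : nat) (r : R) : R :=
  rsum (fun n => / INR n * cos (r * phi (INR n))) a b.

Lemma osc_le_harm (phi : R -> R) (a b : nat) (r : R) : (1 <= a)%nat ->
  Rabs (osc phi a b r) <= harm a b.
Proof.
intros Ha. apply (rsum_inv_le (fun n => cos (r * phi (INR n)))); [easy|].
intros n. apply Rabs_cos_le.
Qed.

Definition diff (h : nat) (f : R -> R) (x : R) : R := f (x + INR h) - f x.

Fixpoint diffs (hs : list nat) (f : R -> R) : R -> R :=
  match hs with
  | nil => f
  | h :: hs => diff h (diffs hs f)
  end.

(** In the inequality [H] can be fixed before [r], so only finitely many correlations occur. Those
    off the diagonal are sums with a differenced phase, hence [o(ln r)]; the diagonal gains a factor
    [1/H] over the trivial bound. *)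
Lemma van_der_Corput (A B : R -> nat) (m : R) (phi : R -> R) : 0 < m ->
  Rbar_locally p_infty (fun r => (1 <= A r <= B r)%nat /\ harm (A r) (B r) <= m * ln r) ->
  (forall h, (0 < h)%nat -> sublog (fun r => osc (diff h phi) (A r) (B r) r)) ->
  sublog (fun r => osc phi (A r) (B r) r).
Proof.
intros Hm HAB Hd.
set (c := fun h k r => rsum (fun n => / INR n *
  cos (r * phi (INR (n + h)) - r * phi (INR (n + k)))) (A r) (B r)).
(* Translating [n] by [k] turns the correlation of [h] and [k] into a sum with phase
   [diff (h - k) phi], up to [2 k]. The case [h < k] follows since the cosine is even. *)
assert (Hlt : forall h k, (k < h)%nat -> sublog (c h k)).
{ intros h k Hkh.
  apply sublog_of_bounded_diff with (1 := Hd (h - k)%nat ltac:(lia)) (m := 2 * INR k).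
  revert HAB. apply eventually_imp. intros r [[HA HB] _].
  assert (P := rsum_inv_shift (fun n => cos (r * diff (h - k) phi (INR n)))
    (A r) (B r) k HA HB (fun n => Rabs_cos_le _)).
  unfold c, osc. rewrite (rsum_ext _ (fun n => / INR n *
    cos (r * diff (h - k) phi (INR (n + k))))); [exact P|].
  intros n _. unfold diff. rewrite <- plus_INR.
  replace (n + k + (h - k))%nat with (n + h)%nat by lia.
  do 2 f_equal. ring. }
assert (Hne : forall h k, h <> k -> sublog (c h k)).
{ intros h k Hhk. destruct (Nat.lt_gt_cases h k) as [Hc _].
  destruct (Hc Hhk) as [H|H]; [|now apply Hlt].
  apply sublog_ext with (1 := Hlt k h H). apply filter_forall. intros r.
  apply rsum_ext. intros n _. f_equal. rewrite <- cos_neg. f_equal. ring. }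
intros eps Heps.
(* The choices of [eta], [mu] and [H] bound the harmonic, off-diagonal and diagonal terms by
   [eps/4 * ln r] each; the last quarter covers the shift error [2 H] for large [r]. *)
set (eta := eps / (2 * m)).
assert (Heta : 0 < eta) by (apply Rdiv_lt_0_compat; lra).
set (mu := eps * eta / 2).
assert (Hmu : 0 < mu) by (unfold mu; nra).
destruct (INR_unbounded (2 * m / (eps * eta))) as [H0 HH0].
set (H := S H0).
assert (HH : 2 * m / (eps * eta) <= INR H) by (unfold H; rewrite S_INR; lra).
assert (HH1 : 1 <= INR H) by (apply INR_ge_1; unfold H; lia).
assert (Hc : forall h k, Rbar_locally p_infty (fun r =>
  c h k r <= (if Nat.eqb h k then m * ln r else 0) + mu * ln r)).
{ intros h k. destruct (Nat.eqb_spec h k) as [<-|Hhk].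
  - generalize (eventually_and HAB (eventually_ln_ge 0)).
    apply eventually_imp. intros r [[HA HW] Hr].
    assert (0 <= mu * ln r) by (apply Rmult_le_pos; lra).
    apply Rle_trans with (harm (A r) (B r)); [|lra].
    unfold c. apply rsum_le. intros n _.
    rewrite Rminus_diag, cos_0. lra.
  - generalize (Hne h k Hhk mu Hmu). apply eventually_imp. intros r Hr.
    apply Rle_trans with (1 := Rle_abs _). lra. }
assert (Hc' := eventually_bounded_forall _ H (fun h => eventually_bounded_forall _ H (Hc h))).
generalize (eventually_and HAB (eventually_and Hc'
  (eventually_ln_ge (Rmax 0 (8 * INR H / eps))))).
apply eventually_imp. clear Hc Hc'. intros r [[[HA HB] HW] [Hc Hr]].
assert (Hr0 : 0 <= ln r) by (apply Rle_trans with (2 := Hr), Rmax_l).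
assert (Hr1 : 2 * INR H <= eps / 4 * ln r).
{ apply Rle_trans with (eps / 4 * (8 * INR H / eps)).
  - right. field. lra.
  - apply Rmult_le_compat_l; [lra|]. apply Rle_trans with (2 := Hr), Rmax_r. }
assert (V := van_der_Corput_inequality (fun n => r * phi (INR n)) (A r) (B r) H eta
  HA HB ltac:(unfold H; lia) Heta).
cbv beta in V. fold (osc phi (A r) (B r) r) in V.
assert (Q : rsum (fun h => rsum (fun k => c h k r) 0 H) 0 H <=
  (INR H * m + INR H ^ 2 * mu) * ln r).
{ apply Rle_trans with (rsum (fun _ => m * ln r + INR H * (mu * ln r)) 0 H).
  - apply rsum_le. intros h Hh.
    apply Rle_trans with
      (rsum (fun k => (if Nat.eqb h k then m * ln r else 0) + mu * ln r) 0 H).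
    + apply rsum_le. intros k Hk. apply Hc; lia.
    + rewrite rsum_plus, rsum_const, Nat.sub_0_r.
      apply Rplus_le_compat_r, rsum_delta, Rmult_le_pos; lra.
  - rewrite rsum_const, Nat.sub_0_r. right. ring. }
unfold c in Q.
assert (HP : 0 < 2 * eta * INR H ^ 2)
  by (apply Rmult_lt_0_compat; [lra|apply pow_lt; lra]).
apply (Rmult_le_compat_l (/ (2 * eta * INR H ^ 2))) in Q;
  [|now apply Rlt_le, Rinv_0_lt_compat].
apply (Rmult_le_compat_l (eta / 2)) in HW; [|lra].
apply Rle_trans with (1 := V).
replace (/ (2 * eta * INR H ^ 2) * ((INR H * m + INR H ^ 2 * mu) * ln r))
  with ((m / (2 * eta * INR H) + mu / (2 * eta)) * ln r) in Q by (field; lra).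
assert (Em : mu / (2 * eta) = eps / 4) by (unfold mu; field; lra).
assert (Ee : eta / 2 * (m * ln r) = eps / 4 * ln r) by (unfold eta; field; lra).
assert (EH : m / (2 * eta * INR H) <= eps / 4).
{ apply Rmult_le_reg_r with (INR H); [lra|].
  replace (m / (2 * eta * INR H) * INR H) with (eps / 4 * (2 * m / (eps * eta)))
    by (field; lra).
  apply Rmult_le_compat_l; lra. }
apply (Rmult_le_compat_r (ln r)) in EH; [|lra]. rewrite Em in Q.
lra.
Qed.

Lemma van_der_Corput_iterated (A B : R -> nat) (m : R) (k : nat) (phi : R -> R) : 0 < m ->
  Rbar_locally p_infty (fun r => (1 <= A r <= B r)%nat /\ harm (A r) (B r) <= m * ln r) ->
  (forall hs, length hs = k -> List.Forall (lt 0) hs ->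
     sublog (fun r => osc (diffs hs phi) (A r) (B r) r)) ->
  sublog (fun r => osc phi (A r) (B r) r).
Proof.
intros Hm HAB. revert phi. induction k as [|k IH]; intros phi Hd.
- now apply (Hd nil).
- apply IH. intros hs Hk Hpos. apply van_der_Corput with m; [easy..|].
  intros h Hh. apply (Hd (h :: hs)); [simpl; lia|now constructor].
Qed.

(** * Iterated differences of negative powers *)

Lemma is_derive_diffs (hs : list nat) (f f' : R -> R) :
  (forall x, 0 < x -> is_derive f x (f' x)) ->
  forall x, 0 < x -> is_derive (diffs hs f) x (diffs hs f' x).
Proof.
intros Hf. induction hs as [|h hs IH]; [exact Hf|]. intros x Hx. simpl.
apply (is_derive_minus (fun y => diffs hs f (y + INR h)) (diffs hs f) x).
- rewrite <- (Rmult_1_l (diffs hs f' (x + INR h))).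
  apply (is_derive_comp (diffs hs f) (fun y => y + INR h) x).
  + apply IH. assert (H := pos_INR h). lra.
  + auto_derive; [easy|ring].
- now apply IH.
Qed.

Lemma diffs_scal (hs : list nat) (c : R) (f : R -> R) (x : R) :
  diffs hs (fun y => c * f y) x = c * diffs hs f x.
Proof.
revert x. induction hs as [|h hs IH]; intros x; simpl; [easy|].
unfold diff. rewrite !IH. ring.
Qed.

(** Each difference is handled by the mean value theorem: it contributes a factor [- h * p] and
    replaces the exponent [- p] by [- (p + 1)], which is why the induction generalizes over [p]. The
    constant [c] does not depend on [x], and the sign depends only on the number of shifts. *)
Lemma diffs_Rpower (hs : list nat) (p : R) : 0 < p -> List.Forall (lt 0) hs ->
  exists c, 0 < c /\ forall x, 0 < x -> exists xi, x <= xi <= x + INR (list_sum hs) /\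
    diffs hs (fun y => Rpower y (- p)) x =
    (-1) ^ length hs * (c * Rpower xi (- (p + INR (length hs)))).
Proof.
intros Hp Hpos. revert p Hp. induction Hpos as [|h hs Hh Hpos IH]; intros p Hp.
- exists 1. split; [lra|]. intros x Hx. exists x. simpl. split; [lra|].
  rewrite Rplus_0_r. ring.
- destruct (IH (p + 1) ltac:(lra)) as [c [Hc E]].
  assert (Hh1 := INR_ge_1 h Hh).
  exists (INR h * p * c). split.
  { repeat apply Rmult_lt_0_compat; lra. }
  intros x Hx.
  assert (D : forall y, 0 < y -> is_derive (diffs hs (fun y => Rpower y (- p))) y
    (diffs hs (fun y => - p * Rpower y (- (p + 1))) y)).
  { apply is_derive_diffs. intros y Hy. apply is_derive_Reals.
    replace (- (p + 1)) with (- p - 1) by ring.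
    now apply derivable_pt_lim_power. }
  destruct (MVT_gen (diffs hs (fun y => Rpower y (- p))) x (x + INR h)
    (diffs hs (fun y => - p * Rpower y (- (p + 1))))) as [z [Hz Ez]].
  + rewrite Rmin_left, Rmax_right by lra. intros y Hy. apply D. lra.
  + rewrite Rmin_left, Rmax_right by lra. intros y Hy.
    apply continuity_pt_filterlim.
    apply (ex_derive_continuous (K := R_AbsRing) (V := R_NormedModule)).
    eexists. apply D. lra.
  + rewrite Rmin_left, Rmax_right in Hz by lra.
    destruct (E z ltac:(lra)) as [xi [Hxi Exi]].
    exists xi. split.
    { simpl list_sum. rewrite plus_INR. lra. }
    simpl diffs. unfold diff. rewrite Ez, diffs_scal, Exi.
    simpl length. rewrite S_INR.
    replace (p + (INR (length hs) + 1)) with (p + 1 + INR (length hs)) by ring.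
    simpl pow. ring.
Qed.

(** * Cosine sums with slowly varying phase *)

(* With [d n = th (n + 1) - th n], the mean value theorem gives
   [cos (th n) / n = (sin (th (n + 1)) - sin (th n)) / (n d n) + O(d n / n)]. *)
Lemma rsum_inv_cos_le_of_slow_phase (th : nat -> R) (a b : nat) (eta : R) :
  (1 <= a)%nat -> (a <= b)%nat ->
  (forall n, (1 <= n)%nat -> 0 < th (S (S n)) - th (S n) <= th (S n) - th n) ->
  (forall n, (1 <= n)%nat -> 0 < th (S n) - th n) ->
  (forall n, (a <= n <= b)%nat ->
     th (S n) - th n <= eta /\ / (INR n * (th (S n) - th n)) <= eta) ->
  Rabs (rsum (fun n => / INR n * cos (th n)) a b) <= 2 * eta + 3 * eta * harm a b.
Proof.
intros Ha Hab Hdec Hpos Hsmall.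
set (d := fun n => th (S n) - th n).
set (w := fun n => / (INR n * d n)).
assert (Hw : forall n, (1 <= n)%nat -> 0 < w n).
{ intros n Hn. apply Rinv_0_lt_compat, Rmult_lt_0_compat; [|now apply Hpos].
  assert (H := INR_ge_1 n Hn). lra. }
assert (HA := Abel_variation_bound (fun n => sin (th n)) w a b
  ltac:(intros n; apply Rabs_le, SIN_bound) Hab). cbv beta in HA.
(* As [d] decreases, only the factor [1/n] can make [w] fall, by at most [eta/n] per step. So
   [|w (S n) - w n|] is at most the signed increment plus [2 eta/n], and the increments telescope.
   With the boundary terms this leaves [2 w b], whence the smallness hypothesis at [n = b] too. *)
assert (HV : rsum (fun n => Rabs (w (S n) - w n)) a b <= w b - w a + 2 * eta * harm a b).
{ rewrite <- rsum_telescope by easy. unfold harm. rewrite <- rsum_scal, <- rsum_plus.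
  apply rsum_le. intros n Hn.
  assert (Hn1 := INR_ge_1 n ltac:(lia)).
  destruct (Hsmall n ltac:(lia)) as [_ Hwn].
  change (w n <= eta) in Hwn.
  assert (W := Hw n ltac:(lia)).
  assert (D := Hdec n ltac:(lia)).
  assert (D1 : w n * (INR n * / INR (S n)) <= w (S n)).
  { unfold w, d. rewrite S_INR.
    replace (/ (INR n * (th (S n) - th n)) * (INR n * / (INR n + 1)))
      with (/ ((INR n + 1) * (th (S n) - th n))) by (field; lra).
    apply Rinv_le_contravar; [apply Rmult_lt_0_compat; lra|].
    apply Rmult_le_compat_l; lra. }
  assert (D2 : w n * (INR n * / INR (S n)) >= w n - eta * / INR n).
  { rewrite S_INR.
    replace (w n * (INR n * / (INR n + 1))) with (w n - w n * / (INR n + 1))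
      by (field; lra).
    assert (/ (INR n + 1) <= / INR n) by (apply Rinv_le_contravar; lra).
    assert (0 < / (INR n + 1)) by (apply Rinv_0_lt_compat; lra).
    assert (w n * / (INR n + 1) <= eta * / INR n) by (apply Rmult_le_compat; lra).
    lra. }
  assert (0 < eta * / INR n)
    by (apply Rmult_lt_0_compat; [lra|apply Rinv_0_lt_compat; lra]).
  apply Rabs_le. lra. }
(* The sine increment is [d n * cos z], and a second mean value step gives
   [|cos z - cos (th n)| <= d n <= eta]. *)
assert (HE : Rabs (rsum (fun n => / INR n * cos (th n) +
  (-1) * (w n * (sin (th (S n)) - sin (th n)))) a b) <= eta * harm a b).
{ apply Rle_trans with (1 := rsum_abs _ _ _).
  unfold harm. rewrite <- rsum_scal. apply rsum_le. intros n Hn.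
  assert (Hn1 := INR_ge_1 n ltac:(lia)).
  destruct (Hsmall n ltac:(lia)) as [Hdn _].
  assert (D := Hpos n ltac:(lia)).
  destruct (MVT_gen sin (th n) (th (S n)) cos) as [z [Hz Ez]].
  { intros x _. apply is_derive_Reals, derivable_pt_lim_sin. }
  { intros x _. apply continuity_sin. }
  destruct (MVT_gen cos (th n) z (fun x => - sin x)) as [y [Hy Ey]].
  { intros x _. apply is_derive_Reals, derivable_pt_lim_cos. }
  { intros x _. apply continuity_cos. }
  rewrite Rmin_left, Rmax_right in Hz by lra.
  rewrite Ez. unfold w, d.
  replace (/ INR n * cos (th n) + -1 * (/ (INR n * (th (S n) - th n)) *
    (cos z * (th (S n) - th n)))) with (/ INR n * - (cos z - cos (th n)))
    by (field; lra).
  assert (0 < / INR n) by (apply Rinv_0_lt_compat; lra).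
  rewrite Rabs_mult, (Rabs_pos_eq (/ INR n)), Rabs_Ropp, Ey, Rabs_mult by lra.
  rewrite (Rabs_pos_eq (z - th n)), Rabs_Ropp by lra.
  assert (S := proj2 (Rabs_le_between (sin y) 1) (SIN_bound y)).
  assert (S0 := Rabs_pos (sin y)).
  rewrite (Rmult_comm eta). apply Rmult_le_compat_l; nra. }
rewrite rsum_plus, rsum_scal in HE.
assert (Ea := Hw a Ha). assert (Eb := Hw b ltac:(lia)).
rewrite (Rabs_pos_eq (w a)), (Rabs_pos_eq (w b)) in HA by lra.
destruct (Hsmall b ltac:(lia)) as [_ Hwb]. change (w b <= eta) in Hwb.
match type of HE with Rabs (?x + -1 * ?y) <= _ =>
  replace x with ((x + -1 * y) + y) by ring end.
apply Rle_trans with (1 := Rabs_triang _ _). lra.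
Qed.

(** * Integer cut points at powers of [r] *)

(** Rounding up ensures [n >= r^al] for every [n >= cut al r]. The integer is positive, so
    [Z.to_nat] does not change its value. *)
Definition cut (al r : R) : nat := Z.to_nat (up (Rpower r al)).

Lemma cut_bounds (al r : R) : Rpower r al <= INR (cut al r) <= Rpower r al + 1.
Proof.
destruct (archimed (Rpower r al)) as [H1 H2].
assert (H0 : 0 < Rpower r al) by apply exp_pos.
unfold cut. rewrite INR_IZR_INZ, Z2Nat.id.
- lra.
- apply le_IZR. lra.
Qed.

Lemma Rpower_ge_1 (al r : R) : 0 <= al -> 1 <= r -> 1 <= Rpower r al.
Proof.
intros Hal Hr. rewrite <- (Rpower_O r) by lra. now apply Rle_Rpower.
Qed.

Lemma cut_ge_1 (al r : R) : 0 <= al -> 1 <= r -> (1 <= cut al r)%nat.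
Proof.
intros Hal Hr. apply INR_le. simpl (INR 1).
assert (H := Rpower_ge_1 al r Hal Hr). assert (H1 := cut_bounds al r). lra.
Qed.

Lemma cut_le (al be r : R) : 1 <= r -> al <= be -> (cut al r <= cut be r)%nat.
Proof.
intros Hr Hab. unfold cut. apply Z2Nat.inj_le.
- apply le_IZR. assert (H := exp_pos (al * ln r)).
  destruct (archimed (Rpower r al)) as [H1 _]. unfold Rpower in *. lra.
- apply le_IZR. assert (H := exp_pos (be * ln r)).
  destruct (archimed (Rpower r be)) as [H1 _]. unfold Rpower in *. lra.
- assert (H := Rle_Rpower r al be Hr Hab).
  destruct (archimed (Rpower r al)) as [_ H1].
  destruct (archimed (Rpower r be)) as [H2 _].
  apply Z.lt_succ_r, lt_IZR. rewrite succ_IZR. lra.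
Qed.

Lemma ln_cut_bounds (al r : R) : 0 <= al -> 1 <= r ->
  al * ln r <= ln (INR (cut al r)) <= al * ln r + 1.
Proof.
intros Hal Hr. destruct (cut_bounds al r) as [H1 H2].
assert (H0 := Rpower_ge_1 al r Hal Hr).
assert (E : ln (Rpower r al) = al * ln r) by apply ln_exp.
rewrite <- E. split.
- apply ln_le; lra.
- apply Rle_trans with (ln (2 * Rpower r al)); [apply ln_le; lra|].
  rewrite ln_mult by lra.
  assert (L2 : ln 2 <= 1).
  { destruct (ln_succ_bounds 1 ltac:(lra)) as [_ L].
    rewrite ln_1, Rinv_1 in L. replace (1 + 1) with 2 in L by ring. lra. }
  lra.
Qed.

Lemma harm_cut_le (al be r : R) : 0 <= al -> al <= be -> 1 <= r ->
  harm (cut al r) (cut be r) <= (be - al) * ln r + 2.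
Proof.
intros Hal Hab Hr.
assert (H := harm_bounds _ _ (cut_ge_1 al r Hal Hr) (cut_le al be r Hr Hab)).
assert (H1 := ln_cut_bounds al r Hal Hr).
assert (H2 := ln_cut_bounds be r ltac:(lra) Hr). lra.
Qed.

Lemma eventually_Rpower_neg_le (e k eta : R) : 0 < e -> 0 < k -> 0 < eta ->
  Rbar_locally p_infty (fun r => k * Rpower r (- e) <= eta).
Proof.
intros He Hk Heta. generalize (eventually_ln_ge (- ln (eta / k) / e)).
apply eventually_imp. intros r Hr.
assert (Hq : 0 < eta / k) by (apply Rdiv_lt_0_compat; lra).
assert (H : Rpower r (- e) <= eta / k).
{ rewrite <- (exp_ln (eta / k)) by easy.
  apply (Rmult_le_compat_l e) in Hr; [|lra].
  replace (e * (- ln (eta / k) / e)) with (- ln (eta / k)) in Hr by (field; lra).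
  unfold Rpower. destruct (Rle_lt_or_eq_dec (- e * ln r) (ln (eta / k))) as [H|H].
  - lra.
  - now apply Rlt_le, exp_increasing.
  - rewrite H. lra. }
apply (Rmult_le_compat_l k) in H; [|lra].
replace (k * (eta / k)) with eta in H by (field; lra). easy.
Qed.

(** * Cancellation on one block *)

(** The phase increments [d n] have size [r n^(-q-1)]. From [n >= r^a] and [a (q+1) > 1] they tend
    to [0] uniformly; from [n <= 2 r^b] and [b q < 1], the products [n d n], of size [r n^(-q)],
    tend to infinity. The slow phase bound then applies with any fixed [eta]. *)
Lemma sublog_osc_of_power_increments (psi : R -> R) (q c C a b : R) :
  0 < q -> 0 < c -> 0 < C -> 0 < a <= b -> 1 < a * (q + 1) -> b * q < 1 ->
  (forall n, (1 <= n)%nat ->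
     psi (INR (S (S n))) - psi (INR (S n)) <= psi (INR (S n)) - psi (INR n)) ->
  (forall n, (1 <= n)%nat ->
     c * Rpower (INR n) (- (q + 1)) <= psi (INR (S n)) - psi (INR n) <=
     C * Rpower (INR n) (- (q + 1))) ->
  sublog (fun r => osc psi (cut a r) (cut b r) r).
Proof.
intros Hq Hc HC Hab Ha Hb Hdec Hsize eps Heps.
(* For [ln r >= 1] the harmonic sum is at most [(b - a + 2) ln r], so this [eta] turns
   [2 eta + 3 eta * harm] into at most [eps ln r]. *)
set (eta := eps / (2 + 3 * (b - a + 2))).
assert (Heta : 0 < eta) by (apply Rdiv_lt_0_compat; lra).
assert (H2q : 0 < Rpower 2 q) by apply exp_pos.
generalize (eventually_and (eventually_ln_ge 1) (eventually_and (eventually_ge 1)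
  (eventually_and
    (eventually_Rpower_neg_le (a * (q + 1) - 1) C eta ltac:(lra) HC Heta)
    (eventually_Rpower_neg_le (1 - b * q) (Rpower 2 q / c) eta ltac:(lra)
       ltac:(now apply Rdiv_lt_0_compat) Heta)))).
apply eventually_imp. intros r [Hl [Hr [HA HB]]].
assert (Hpos : forall n, (1 <= n)%nat -> 0 < psi (INR (S n)) - psi (INR n)).
{ intros n Hn. apply Rlt_le_trans with (2 := proj1 (Hsize n Hn)).
  apply Rmult_lt_0_compat; [easy|apply exp_pos]. }
assert (P := rsum_inv_cos_le_of_slow_phase (fun n => r * psi (INR n)) (cut a r) (cut b r) eta
  (cut_ge_1 a r ltac:(lra) Hr) (cut_le a b r Hr ltac:(lra))).
cbv beta in P. fold (osc psi (cut a r) (cut b r) r) in P.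
assert (HW := harm_cut_le a b r ltac:(lra) ltac:(lra) Hr).
apply Rle_trans with (2 * eta + 3 * eta * harm (cut a r) (cut b r)).
2: { apply Rle_trans with (eta * (2 + 3 * (b - a + 2)) * ln r).
     2: { right. unfold eta. field. lra. }
     assert (Q : harm (cut a r) (cut b r) <= (b - a + 2) * ln r) by lra.
     apply (Rmult_le_compat_l (3 * eta)) in Q; [|lra]. nra. }
apply P; clear P.
- intros n Hn. assert (H1 := Hdec n Hn). assert (H2 := Hpos (S n) ltac:(lia)).
  rewrite <- !Rmult_minus_distr_l. split.
  + apply Rmult_lt_0_compat; lra.
  + apply Rmult_le_compat_l; lra.
- intros n Hn. rewrite <- Rmult_minus_distr_l.
  apply Rmult_lt_0_compat; [lra|now apply Hpos].
- intros n Hn. rewrite <- Rmult_minus_distr_l.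
  assert (Hn0 : (1 <= n)%nat).
  { assert (H := cut_ge_1 a r ltac:(lra) Hr). lia. }
  assert (Hn1 := INR_ge_1 n Hn0).
  assert (Rb1 := Rpower_ge_1 b r ltac:(lra) Hr).
  assert (HnA : Rpower r a <= INR n).
  { apply Rle_trans with (1 := proj1 (cut_bounds a r)). apply le_INR. lia. }
  assert (HnB : INR n <= 2 * Rpower r b).
  { apply Rle_trans with (INR (cut b r)); [apply le_INR; lia|].
    assert (H := cut_bounds b r). lra. }
  assert (Er : Rpower r 1 = r) by (apply Rpower_1; lra).
  destruct (Hsize n Hn0) as [S1 S2]. split.
  + apply Rle_trans with (2 := HA).
    apply Rle_trans with (r * (C * Rpower (INR n) (- (q + 1)))).
    { apply Rmult_le_compat_l; lra. }
    assert (M : Rpower (INR n) (- (q + 1)) <= Rpower r (- (a * (q + 1)))).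
    { rewrite Rpower_Ropp, Ropp_mult_distr_r, <- Rpower_mult, (Rpower_Ropp (Rpower r a)).
      apply Rinv_le_contravar; [apply exp_pos|].
      apply Rle_Rpower_l; [lra|]. split; [apply exp_pos|easy]. }
    replace (- (a * (q + 1) - 1)) with (1 + - (a * (q + 1))) by ring.
    rewrite Rpower_plus, Er.
    replace (r * (C * Rpower (INR n) (- (q + 1)))) with
      (r * C * Rpower (INR n) (- (q + 1))) by ring.
    replace (C * (r * Rpower r (- (a * (q + 1))))) with
      (r * C * Rpower r (- (a * (q + 1)))) by ring.
    apply Rmult_le_compat_l; [|easy]. apply Rmult_le_pos; lra.
  + apply Rle_trans with (2 := HB).
    assert (En : INR n * Rpower (INR n) (- (q + 1)) = / Rpower (INR n) q).
    { rewrite <- (Rpower_1 (INR n)) at 1 by lra.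
      rewrite <- Rpower_plus, <- Rpower_Ropp. f_equal. ring. }
    assert (0 < Rpower (INR n) q) by apply exp_pos.
    apply Rle_trans with (/ (r * c * / Rpower (INR n) q)).
    { apply Rinv_le_contravar.
      - repeat apply Rmult_lt_0_compat; try lra. now apply Rinv_0_lt_compat.
      - rewrite <- En.
        replace (r * c * (INR n * Rpower (INR n) (- (q + 1)))) with
          (INR n * (r * (c * Rpower (INR n) (- (q + 1))))) by ring.
        apply Rmult_le_compat_l; [lra|]. apply Rmult_le_compat_l; lra. }
    assert (M : Rpower (INR n) q <= Rpower 2 q * Rpower r (b * q)).
    { rewrite <- Rpower_mult, Rpower_mult_distr by lra.
      apply Rle_Rpower_l; lra. }
    replace (- (1 - b * q)) with (b * q + - (1)) by ring.
    rewrite Rpower_plus, (Rpower_Ropp r 1), Er.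
    replace (/ (r * c * / Rpower (INR n) q)) with (/ (r * c) * Rpower (INR n) q)
      by (field; lra).
    replace (Rpower 2 q / c * (Rpower r (b * q) * / r)) with
      (/ (r * c) * (Rpower 2 q * Rpower r (b * q))) by (field; lra).
    apply Rmult_le_compat_l; [|easy].
    apply Rlt_le, Rinv_0_lt_compat, Rmult_lt_0_compat; lra.
Qed.

(** Increments of the differenced phase are differences with one more shift [1], so their size and
    monotonicity come from [diffs_Rpower] with one and two shifts prepended. *)
Lemma sublog_osc_diffs_Rpower (hs : list nat) (t a b : R) :
  0 < t -> List.Forall (lt 0) hs -> 0 < a <= b ->
  1 < a * (t + INR (length hs) + 1) -> b * (t + INR (length hs)) < 1 ->
  sublog (fun r => osc (diffs hs (fun x => 2 * Rpower x (- t))) (cut a r) (cut b r) r).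
Proof.
intros Ht Hpos Hab Ha Hb.
set (k := length hs) in *. set (f := fun x => Rpower x (- t)).
(* This sign makes the phase increasing; it is harmless because the cosine is even. *)
set (sg := (-1) ^ S k).
assert (Hsg : sg * sg = 1).
{ unfold sg. rewrite <- Rpow_mult_distr. replace (-1 * -1) with 1 by ring. apply pow1. }
destruct (diffs_Rpower (1 :: hs)%nat%list t Ht ltac:(now constructor; [lia|]))
  as [c1 [Hc1 E1]].
destruct (diffs_Rpower (1 :: 1 :: hs)%nat%list t Ht
  ltac:(now constructor; [lia|constructor; [lia|]])) as [c2 [Hc2 E2]].
fold f in E1, E2.
set (psi := fun x => sg * diffs hs (fun x => 2 * f x) x).
assert (D1 : forall n, psi (INR (S n)) - psi (INR n) =
  2 * (sg * diffs (1 :: hs)%nat%list f (INR n))).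
{ intros n. unfold psi. rewrite !diffs_scal, S_INR. simpl diffs. unfold diff.
  simpl (INR 1). ring. }
assert (D2 : forall n, psi (INR (S (S n))) - psi (INR (S n)) - (psi (INR (S n)) - psi (INR n)) =
  2 * (sg * diffs (1 :: 1 :: hs)%nat%list f (INR n))).
{ intros n. rewrite !D1, S_INR. simpl diffs. unfold diff. simpl (INR 1). ring. }
set (q := t + INR k).
assert (Hk := pos_INR k).
assert (Hq : 0 < q) by (unfold q; lra).
set (s := INR (list_sum (1 :: hs)%nat%list)).
assert (Hs : 0 <= s) by apply pos_INR.
apply sublog_ext with (fun r => osc psi (cut a r) (cut b r) r).
(* The intermediate point satisfies [xi <= n + s <= (1 + s) n] for [n >= 1], which gives the lower
   constant. *)
- assert (Rpower (1 + s) (- (q + 1)) > 0) by apply exp_pos.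
  apply sublog_osc_of_power_increments with q (2 * c1 * Rpower (1 + s) (- (q + 1))) (2 * c1);
    try assumption; try lra.
  + repeat apply Rmult_lt_0_compat; lra.
  + intros n Hn. assert (Hn1 := INR_ge_1 n Hn).
    destruct (E2 (INR n) ltac:(lra)) as [xi [_ Ex]].
    specialize (D2 n). rewrite Ex in D2.
    change ((-1) ^ length (1 :: 1 :: hs)%nat%list) with (-1 * sg) in D2.
    set (y := Rpower xi _) in D2. assert (0 < y) by apply exp_pos.
    replace (2 * (sg * (-1 * sg * (c2 * y)))) with (- (2 * (sg * sg) * (c2 * y))) in D2 by ring.
    rewrite Hsg in D2. assert (0 < c2 * y) by (apply Rmult_lt_0_compat; lra). lra.
  + intros n Hn. assert (Hn1 := INR_ge_1 n Hn).
    destruct (E1 (INR n) ltac:(lra)) as [xi [Hxi Ex]].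
    rewrite D1, Ex. fold s in Hxi.
    change ((-1) ^ length (1 :: hs)%nat%list) with sg.
    change (length (1 :: hs)%nat%list) with (S k).
    rewrite S_INR. replace (t + (INR k + 1)) with (q + 1) by (unfold q; ring).
    replace (2 * (sg * (sg * (c1 * Rpower xi (- (q + 1)))))) with
      (sg * sg * (2 * c1 * Rpower xi (- (q + 1)))) by ring.
    rewrite Hsg, Rmult_1_l.
    assert (M : forall x y, 0 < x <= y -> Rpower y (- (q + 1)) <= Rpower x (- (q + 1))).
    { intros x y Hxy. rewrite !Rpower_Ropp. apply Rinv_le_contravar; [apply exp_pos|].
      apply Rle_Rpower_l; lra. }
    split.
    * rewrite Rmult_assoc, Rpower_mult_distr by lra.
      apply Rmult_le_compat_l; [lra|]. apply M. split; [lra|nra].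
    * apply Rmult_le_compat_l; [lra|]. apply M. lra.
- apply filter_forall. intros r. apply rsum_ext. intros n _. f_equal. unfold psi.
  change (fun x => 2 * f x) with (fun x => 2 * Rpower x (- t)).
  set (y := diffs hs _ (INR n)).
  assert (Hs1 : sg = 1 \/ sg = -1).
  { assert (H : (sg - 1) * (sg + 1) = 0) by lra.
    apply Rmult_integral in H. lra. }
  destruct Hs1 as [Hs1 | Hs1]; rewrite Hs1.
  + f_equal. ring.
  + rewrite <- cos_neg. f_equal. ring.
Qed.

(** The strict conditions on [a] and [b] fail only at the ends of the block. Trimming both exponents
    by [eta] loses two pieces, each trivially at most [eta ln r + 2]. *)
Lemma sublog_osc_block (phi : R -> R) (q : R) : 0 < q ->
  (forall a b, 0 < a <= b -> 1 < a * (q + 1) -> b * q < 1 ->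
     sublog (fun r => osc phi (cut a r) (cut b r) r)) ->
  sublog (fun r => osc phi (cut (/ (q + 1)) r) (cut (/ q) r) r).
Proof.
intros Hq Hphi eps Heps.
set (lo := / (q + 1)). set (hi := / q).
assert (Hlo : 0 < lo) by (apply Rinv_0_lt_compat; lra).
assert (Hlohi : lo < hi) by (apply Rinv_lt_contravar; nra).
(* The bound [eps/8] controls the trimmed pieces, and a third of the length keeps the trimmed block
   nonempty. *)
set (eta := Rmin (eps / 8) ((hi - lo) / 3)).
assert (He1 : eta <= eps / 8) by apply Rmin_l.
assert (He2 : eta <= (hi - lo) / 3) by apply Rmin_r.
assert (He : 0 < eta) by (apply Rmin_glb_lt; lra).
assert (Elo : lo * (q + 1) = 1) by (apply Rinv_l; lra).
assert (Ehi : hi * q = 1) by (apply Rinv_l; lra).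
assert (S := Hphi (lo + eta) (hi - eta) ltac:(lra) ltac:(nra) ltac:(nra)
  (eps / 2) ltac:(lra)).
generalize (eventually_and S (eventually_and (eventually_ge 1) (eventually_ln_ge (16 / eps)))).
apply eventually_imp. clear S. intros r [S [Hr Hl]].
apply (Rmult_le_compat_l (eps / 4)) in Hl; [|lra].
replace (eps / 4 * (16 / eps)) with 4 in Hl by (field; lra).
assert (C1 := cut_le lo (lo + eta) r Hr ltac:(lra)).
assert (C2 := cut_le (lo + eta) (hi - eta) r Hr ltac:(lra)).
assert (C3 := cut_le (hi - eta) hi r Hr ltac:(lra)).
unfold osc at 1.
rewrite (rsum_Chasles _ _ _ _ C1), (rsum_Chasles _ _ _ (cut hi r) C2) by (easy || lia).
fold (osc phi (cut lo r) (cut (lo + eta) r) r).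
fold (osc phi (cut (lo + eta) r) (cut (hi - eta) r) r).
fold (osc phi (cut (hi - eta) r) (cut hi r) r).
assert (O1 := osc_le_harm phi _ (cut (lo + eta) r) r (cut_ge_1 lo r ltac:(lra) Hr)).
assert (O3 := osc_le_harm phi _ (cut hi r) r (cut_ge_1 (hi - eta) r ltac:(lra) Hr)).
assert (H1 := harm_cut_le lo (lo + eta) r ltac:(lra) ltac:(lra) Hr).
assert (H3 := harm_cut_le (hi - eta) hi r ltac:(lra) ltac:(lra) Hr).
assert (0 <= ln r) by (rewrite <- ln_1; apply ln_le; lra).
assert (eta * ln r <= eps / 8 * ln r) by (apply Rmult_le_compat_r; lra).
apply Rle_trans with (1 := Rabs_triang _ _).
assert (T := Rabs_triang (osc phi (cut (lo + eta) r) (cut (hi - eta) r) r)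
  (osc phi (cut (hi - eta) r) (cut hi r) r)).
lra.
Qed.

(** * Assembly of the blocks *)

Lemma sublog_osc_Rpower (t : R) : 0 < t ->
  sublog (fun r => osc (fun x => 2 * Rpower x (- t)) 1 (cut (/ t) r) r).
Proof.
intros Ht. set (phi := fun x => 2 * Rpower x (- t)).
assert (Hblock : forall k, sublog (fun r =>
  osc phi (cut (/ (t + INR k + 1)) r) (cut (/ (t + INR k)) r) r)).
{ intros k. assert (Hk := pos_INR k).
  apply sublog_osc_block; [lra|]. intros a b Hab Ha Hb.
  apply van_der_Corput_iterated with (m := b - a + 2) (k := k); [lra| |].
  - generalize (eventually_and (eventually_ge 1) (eventually_ln_ge 1)).
    apply eventually_imp. intros r [Hr Hl]. repeat split.
    + apply cut_ge_1; lra.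
    + apply cut_le; lra.
    + assert (H := harm_cut_le a b r ltac:(lra) ltac:(lra) Hr). lra.
  - intros hs <- Hpos. now apply sublog_osc_diffs_Rpower. }
assert (Hinv : forall k, 0 < / (t + INR k) <= / t).
{ intros k. assert (Hk := pos_INR k). split.
  - apply Rinv_0_lt_compat. lra.
  - apply Rinv_le_contravar; lra. }
(* Consecutive blocks share an end point, so finitely many of them chain together. *)
assert (Hcover : forall k, sublog (fun r =>
  osc phi (cut (/ (t + INR k)) r) (cut (/ t) r) r)).
{ induction k as [|k IH].
  - intros eps Heps. generalize (eventually_ln_ge 0). apply eventually_imp.
    intros r Hr. simpl INR. rewrite Rplus_0_r. unfold osc. rewrite rsum_nil, Rabs_R0.
    apply Rmult_le_pos; lra.
  - apply sublog_ext with (1 := sublog_plus _ _ (Hblock k) IH).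
    generalize (eventually_ge 1). apply eventually_imp. intros r Hr.
    rewrite S_INR, <- Rplus_assoc. symmetry. apply rsum_Chasles; apply cut_le; try lra.
    + assert (Hk := pos_INR k). apply Rinv_le_contravar; lra.
    + apply Hinv. }
intros eps Heps.
(* The number of blocks depends on [eps] alone; the range below them contributes at most
   [eps/4 * ln r + 2]. *)
destruct (INR_unbounded (4 / eps)) as [k Hk].
assert (Hk4 : / (t + INR k) <= eps / 4).
{ replace (eps / 4) with (/ (4 / eps)) by (field; lra).
  apply Rinv_le_contravar; [apply Rdiv_lt_0_compat; lra|lra]. }
generalize (eventually_and (Hcover k (eps / 2) ltac:(lra))
  (eventually_and (eventually_ge 1) (eventually_ln_ge (8 / eps)))).
apply eventually_imp. intros r [S [Hr Hl]].
destruct (Hinv k) as [Hk0 Hk1].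
set (al := / (t + INR k)) in *.
assert (C1 := cut_ge_1 al r ltac:(lra) Hr).
unfold osc at 1. rewrite (rsum_Chasles _ _ _ _ C1) by (apply cut_le; lra).
fold (osc phi 1 (cut al r) r). fold (osc phi (cut al r) (cut (/ t) r) r).
assert (O := osc_le_harm phi 1 (cut al r) r (le_n 1)).
assert (H := harm_bounds 1 (cut al r) (le_n 1) C1).
simpl (INR 1) in H. rewrite ln_1 in H.
assert (L := ln_cut_bounds al r ltac:(lra) Hr).
assert (0 <= ln r) by (rewrite <- ln_1; apply ln_le; lra).
assert (al * ln r <= eps / 4 * ln r) by (apply Rmult_le_compat_r; lra).
apply (Rmult_le_compat_l (eps / 4)) in Hl; [|lra].
replace (eps / 4 * (8 / eps)) with 2 in Hl by (field; lra).
apply Rle_trans with (1 := Rabs_triang _ _). lra.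
Qed.

(** * From the cosine sum to [g] *)

Lemma rsum_inv_Rpower_le (s : R) (a b : nat) : 0 < s -> (1 <= a)%nat -> (a <= b)%nat ->
  rsum (fun n => / INR n * Rpower (INR n) (- s)) a b <= (1 + / s) * Rpower (INR a) (- s).
Proof.
intros Hs Ha Hab.
assert (Hi : 0 < / s) by now apply Rinv_0_lt_compat.
(* [Rpower_telescope] bounds the term at [b + 1], not at [b]; the first difference on the right
   makes up for this offset by one. *)
assert (E : rsum (fun n => / INR n * Rpower (INR n) (- s)) a b <=
  (/ INR a * Rpower (INR a) (- s) - / INR b * Rpower (INR b) (- s)) +
  / s * (Rpower (INR a) (- s) - Rpower (INR b) (- s))).
{ induction Hab as [|b Hab IH].
  - rewrite rsum_nil. lra.
  - rewrite rsum_S by lia.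
    assert (Hb := INR_ge_1 b ltac:(lia)).
    assert (T := Rpower_telescope s (INR b) Hs ltac:(lra)).
    rewrite <- S_INR in T. apply (Rmult_le_compat_l (/ s)) in T; [|lra].
    replace (/ s * (s * Rpower (INR (S b)) (- s) * / INR (S b)))
      with (/ INR (S b) * Rpower (INR (S b)) (- s)) in T.
    2: { rewrite S_INR. field. lra. }
    lra. }
apply Rle_trans with (1 := E).
assert (Ha1 := INR_ge_1 a Ha). assert (Hb1 := INR_ge_1 b ltac:(lia)).
assert (0 < Rpower (INR a) (- s)) by apply exp_pos.
assert (0 < Rpower (INR b) (- s)) by apply exp_pos.
assert (0 < / INR b) by (apply Rinv_0_lt_compat; lra).
assert (/ INR a <= 1) by (rewrite <- Rinv_1; apply Rinv_le_contravar; lra).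
assert (0 <= / INR b * Rpower (INR b) (- s)) by (apply Rmult_le_pos; lra).
assert (0 <= / s * Rpower (INR b) (- s)) by (apply Rmult_le_pos; lra).
nra.
Qed.

(** Below [N] the half-angle identity is exact. Beyond it [sin^2 x <= x^2] and [N >= r^(1/t)] give
    [r^2 N^(-2t) <= 1], so the tail is at most [1 + 1/(2t)]. *)
Lemma g_osc_bound (t r : R) : 0 < t -> 1 <= r ->
  Rabs (g t r - (harm 1 (cut (/ t) r) -
    osc (fun x => 2 * Rpower x (- t)) 1 (cut (/ t) r) r) / 2) <= 1 + / (2 * t).
Proof.
intros Ht Hr.
assert (Hit : 0 < / t) by now apply Rinv_0_lt_compat.
set (N := cut (/ t) r).
assert (HN : (1 <= N)%nat) by (apply cut_ge_1; lra).
set (u := fun n => / INR n * (sin (Rpower (INR n) (- t) * r)) ^ 2).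
assert (Hu0 : forall n, (1 <= n)%nat -> 0 <= u n).
{ intros n Hn. apply Rmult_le_pos; [|apply pow2_ge_0].
  apply Rlt_le, Rinv_0_lt_compat, lt_0_INR. lia. }
assert (Hhead : rsum u 1 N = (harm 1 N - osc (fun x => 2 * Rpower x (- t)) 1 N r) / 2).
{ unfold harm, osc.
  match goal with |- _ = (?x - ?y) / 2 =>
    replace ((x - y) / 2) with (/ 2 * x + - / 2 * y) by field end.
  rewrite <- !rsum_scal, <- rsum_plus. apply rsum_ext. intros n _. unfold u.
  replace (r * (2 * Rpower (INR n) (- t))) with (2 * (Rpower (INR n) (- t) * r)) by ring.
  rewrite cos_2a_sin. lra. }
rewrite <- Hhead.
assert (Htail : forall M, (N <= M)%nat ->
  rsum u 1 N <= rsum u 1 M <= rsum u 1 N + (1 + / (2 * t))).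
{ intros M HM. rewrite (rsum_Chasles u 1 N M) by easy.
  assert (T0 : rsum (fun _ => 0) N M <= rsum u N M).
  { apply rsum_le. intros n Hn. apply Hu0. lia. }
  rewrite rsum_const, Rmult_0_r in T0.
  assert (T1 : rsum u N M <= r ^ 2 * ((1 + / (2 * t)) * Rpower (INR N) (- (2 * t)))).
  { apply Rle_trans with
      (r ^ 2 * rsum (fun n => / INR n * Rpower (INR n) (- (2 * t))) N M).
    - rewrite <- rsum_scal. apply rsum_le. intros n Hn. unfold u.
      assert (Hn1 := INR_ge_1 n ltac:(lia)).
      assert (0 < / INR n) by (apply Rinv_0_lt_compat; lra).
      replace (- (2 * t)) with (- t + - t) by ring. rewrite Rpower_plus.
      replace (r ^ 2 * (/ INR n * (Rpower (INR n) (- t) * Rpower (INR n) (- t))))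
        with (/ INR n * (Rpower (INR n) (- t) * r) ^ 2) by ring.
      apply Rmult_le_compat_l; [lra|apply sin_sqr_le].
    - apply Rmult_le_compat_l; [apply pow2_ge_0|].
      apply rsum_inv_Rpower_le; [lra|easy..]. }
  assert (T2 : r ^ 2 * Rpower (INR N) (- (2 * t)) <= 1).
  { apply Rle_trans with (r ^ 2 * Rpower (Rpower r (/ t)) (- (2 * t))).
    - apply Rmult_le_compat_l; [apply pow2_ge_0|]. rewrite !Rpower_Ropp.
      apply Rinv_le_contravar; [apply exp_pos|]. apply Rle_Rpower_l; [lra|].
      split; [apply exp_pos|apply cut_bounds].
    - rewrite Rpower_mult, <- (Rpower_pow 2 r), <- Rpower_plus by lra.
      replace (INR 2 + / t * - (2 * t)) with 0 by (simpl; field; lra).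
      rewrite Rpower_O by lra. lra. }
  assert (0 < / (2 * t)) by (apply Rinv_0_lt_compat; lra).
  assert (T3 := Rmult_le_compat_l (1 + / (2 * t)) _ _ ltac:(lra) T2).
  lra. }
(* The terms [k = 0..M] are [n = 1..M+1], hence the exclusive upper end [M + 2]. *)
assert (Hsum : forall M, sum_n (fun k => u (S k)) M = rsum u 1 (S (S M))).
{ intros M. induction M as [|M IH].
  - rewrite sum_O. rewrite rsum_S, rsum_nil by lia. symmetry. apply Rplus_0_l.
  - rewrite sum_Sn, IH, (rsum_S u 1 (S (S M))) by lia. easy. }
assert (Hlim : is_lim_seq (sum_n (fun k => u (S k))) (g t r)) by exact (is_series_g t r Ht).
assert (Hlo : Rbar_le (rsum u 1 N) (g t r)).
{ apply is_lim_seq_le_loc with (2 := is_lim_seq_const _) (3 := Hlim).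
  exists N. intros M HM. rewrite Hsum. apply Htail. lia. }
assert (Hhi : Rbar_le (g t r) (rsum u 1 N + (1 + / (2 * t)))).
{ apply is_lim_seq_le_loc with (2 := Hlim) (3 := is_lim_seq_const _).
  exists N. intros M HM. rewrite Hsum. apply Htail. lia. }
simpl in Hlo, Hhi. apply Rabs_le. lra.
Qed.

Lemma sublog_g (t : R) : 0 < t -> sublog (fun r => g t r - ln r / (2 * t)).
Proof.
intros Ht.
assert (Hit : 0 < / t) by now apply Rinv_0_lt_compat.
assert (S : sublog (fun r => - / 2 * osc (fun x => 2 * Rpower x (- t)) 1 (cut (/ t) r) r)).
{ intros eps Heps. generalize (sublog_osc_Rpower t Ht eps Heps).
  apply eventually_imp. intros r Hr.
  rewrite Rabs_mult, Rabs_Ropp, (Rabs_pos_eq (/ 2)) by lra.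
  assert (P := Rabs_pos (osc (fun x => 2 * Rpower x (- t)) 1 (cut (/ t) r) r)). lra. }
(* The head gives [harm / 2], where [harm] exceeds [ln r / t] by at most [2]; this adds [1] to the
   bound of [g_osc_bound]. *)
apply sublog_of_bounded_diff with (1 := S) (m := 2 + / (2 * t)).
generalize (eventually_ge 1). apply eventually_imp. intros r Hr.
assert (B := g_osc_bound t r Ht Hr).
assert (C1 := cut_ge_1 (/ t) r ltac:(lra) Hr).
assert (H := harm_bounds 1 (cut (/ t) r) (le_n 1) C1).
simpl (INR 1) in H. rewrite ln_1 in H.
assert (L := ln_cut_bounds (/ t) r ltac:(lra) Hr).
replace (ln r / (2 * t)) with (/ t * ln r / 2) by (field; lra).
apply Rabs_le_between in B. apply Rabs_le. lra.
Qed.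

Theorem proposition4p5 (t : R) (ht : 0 < t) :
  exists eps : R -> R,
    is_lim eps p_infty 0 /\
    Rbar_locally p_infty (fun r : R =>
      g t r = 1 / (2 * t) * ln r * (1 + eps r)).
Proof.
exists (fun r => (g t r - ln r / (2 * t)) * (2 * t) / ln r). split.
- apply is_lim_spec. intros [e He]. simpl.
  (* With [e / (4 t)], the factor [2 t] in the relative error leaves [e / 2 < e]. *)
  generalize (eventually_and (sublog_g t ht (e / (4 * t)) ltac:(apply Rdiv_lt_0_compat; lra))
    (eventually_ln_ge 1)).
  apply eventually_imp. intros r [H1 H2]. rewrite Rminus_0_r.
  unfold Rdiv at 1.
  rewrite !Rabs_mult, (Rabs_pos_eq 2), (Rabs_pos_eq t), Rabs_inv, (Rabs_pos_eq (ln r)) by lra.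
  apply Rmult_lt_reg_r with (ln r); [lra|].
  rewrite Rmult_assoc, Rinv_l, Rmult_1_r by lra.
  apply (Rmult_le_compat_r (2 * t)) in H1; [|lra].
  replace (e / (4 * t) * ln r * (2 * t)) with (e / 2 * ln r) in H1 by (field; lra).
  nra.
- generalize (eventually_ln_ge 1). apply eventually_imp. intros r Hr. field. lra.
Qed.
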